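(* Let $\sigma_1,\sigma_2,\sigma_3$ be the Cartan–Maurer forms on $\mathbb S^3$. Then any ($4$-dimensional Riemannian) Einstein metric which can be expressed locally in the form $$\psi(r^2)\,\mathrm{d}r^2+\phi(r^2)\,\sigma_1^2+\varphi(r^2)(\sigma_2^2+\sigma_3^2)$$ must be, after normalization (reparametrization of $r$), one of $$\bar\alpha^2=\left(1+Fr^{-4}-\frac{\bar\mu}{2}r^2\right)^{-1}\mathrm{d}r^2+\left(1+Fr^{-4}-\frac{\bar\mu}{2}r^2\right)r^2\sigma_1^2+r^2(\sigma_2^2+\sigma_3^2)$$ or $$\bar\alpha^2=\Omega\,\mathrm{d}r^2+(1+Er^2)^{-1}\Omega^{-1}r^2\sigma_1^2+r^2(\sigma_2^2+\sigma_3^2),$$ where $$\Omega:=\frac{r^4}{(1+Er^2)\left\{F\sqrt{1+Er^2}-E^{-3}\left[\bar\mu(1+Er^2)^2-2(2E+3\bar\mu)(1+Er^2)-(4E+3\bar\mu)\right]\right\}},$$ $E\neq0$ and $F$ are constants, and $\bar\mu$ is the Ricci constant of the metric.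
   Context: With $r:=\sqrt{(x^1)^2+(x^2)^2+(x^3)^2+(x^4)^2}$ on $\mathbb R^4\setminus\{0\}$, the Cartan–Maurer forms are $$\sigma_1=\frac{1}{r^2}(x^2\,\mathrm dx^1-x^1\,\mathrm dx^2+x^4\,\mathrm dx^3-x^3\,\mathrm dx^4),$$ $$\sigma_2=\frac{1}{r^2}(x^3\,\mathrm dx^1-x^4\,\mathrm dx^2-x^1\,\mathrm dx^3+x^2\,\mathrm dx^4),$$ $$\sigma_3=\frac{1}{r^2}(x^4\,\mathrm dx^1+x^3\,\mathrm dx^2-x^2\,\mathrm dx^3-x^1\,\mathrm dx^4),$$ so that the Euclidean metric is $\mathrm dr^2+r^2(\sigma_1^2+\sigma_2^2+\sigma_3^2)$. Here $\psi,\phi,\varphi$ are smooth positive functions of one variable. A metric in dimension $4$ is Einstein with Ricci constant $\bar\mu$ if its Ricci tensor equals $3\bar\mu$ times the metric, with $\bar\mu$ constant.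
   Formalization: The normal form is claimed on intervals of r where φ-variant ϕ (coefficient of σ2²+σ3²) has nonzero derivative; such radii are proved dense. At a critical radius none exists, e.g. dr²+sin²r(σ1²+σ2²+σ3²) at r=π/2. *)

(* Defs.v *)
From HB Require Import structures.
From mathcomp Require Import all_boot all_order all_algebra.
From mathcomp Require Import all_classical all_reals all_analysis.

Set Implicit Arguments.
Unset Strict Implicit.
Unset Printing Implicit Defensive.

Import Order.TTheory GRing.Theory Num.Theory.
Import numFieldNormedType.Exports.

Local Open Scope classical_set_scope.
Local Open Scope ring_scope.

Section Ricci.
Context {R : realType} {n : nat}.
Implicit Types (g : 'rV[R]_n.+1 -> 'M[R]_n.+1) (x : 'rV[R]_n.+1).

Definition partial (k : 'I_n.+1) (f : 'rV[R]_n.+1 -> R) x : R :=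
  'D_(delta_mx 0 k) f x.

(* the component dx^k of the differential is the k-th entry *)
Definition dform (f : 'rV[R]_n.+1 -> R) x : 'rV[R]_n.+1 :=
  \row_k partial k f x.

(* matrix of the symmetric tensor w (x) w *)
Definition sqform (w : 'rV[R]_n.+1) : 'M[R]_n.+1 := w^T *m w.

(* Gamma^k_ij *)
Definition christoffel g (k i j : 'I_n.+1) x : R :=
  2^-1 * \sum_l invmx (g x) k l *
    (partial i (fun y => g y j l) x + partial j (fun y => g y i l) x
     - partial l (fun y => g y i j) x).

(* Sign convention: the round spheres have positive Ricci tensor. *)
Definition ricci g x : 'M[R]_n.+1 :=
  \matrix_(i, j)
    (\sum_k partial k (christoffel g k i j) x
     - \sum_k partial j (christoffel g k i k) x
     + \sum_k \sum_l (christoffel g k k l x * christoffel g l i j x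
                      - christoffel g k j l x * christoffel g l i k x)).

End Ricci.

Section BianchiMetrics.
Context {R : realType}.
Implicit Types (x : 'rV[R]_4) (U : set 'rV[R]_4).

(* Normalization of the Ricci constant in dimension 4: Ric = (4 - 1) mu g. *)
Definition einstein U (g : 'rV[R]_4 -> 'M[R]_4) (mu : R) : Prop :=
  forall x, U x -> ricci g x = (3 * mu) *: g x.

Definition smooth_on (A : set R) (f : R -> R) : Prop :=
  forall (m : nat) (t : R), A t -> derivable (derive1n m f) t 1.

Definition euclid_r x : R := Num.sqrt (\sum_i x 0 i ^+ 2).

Definition covector (a b c d : R) : 'rV[R]_4 :=
  \row_(k < 4) [:: a; b; c; d]`_k.

Definition sigma1 x : 'rV[R]_4 :=
  (euclid_r x ^- 2) *: covector (x 0 1) (- x 0 0) (x 0 3) (- x 0 2).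

Definition sigma2 x : 'rV[R]_4 :=
  (euclid_r x ^- 2) *: covector (x 0 2) (- x 0 3) (- x 0 0) (x 0 1).

Definition sigma3 x : 'rV[R]_4 :=
  (euclid_r x ^- 2) *: covector (x 0 3) (x 0 2) (- x 0 1) (- x 0 0).

(* P(rho) drho^2 + Q(rho) sigma_1^2 + S(rho) (sigma_2^2 + sigma_3^2), where
   rho is any radial coordinate function.  Since the sigma_i are invariant
   under radial rescalings, reparametrizing r means replacing the function
   rho = euclid_r by rho = h o euclid_r. *)
Definition radial_metric (rho : 'rV[R]_4 -> R) (P Q S : R -> R) x : 'M[R]_4 :=
  P (rho x) *: sqform (dform rho x) + Q (rho x) *: sqform (sigma1 x)
  + S (rho x) *: (sqform (sigma2 x) + sqform (sigma3 x)).

Definition bianchi_metric (psi phi vphi : R -> R) : 'rV[R]_4 -> 'M[R]_4 :=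
  radial_metric euclid_r (fun s => psi (s ^+ 2)) (fun s => phi (s ^+ 2))
    (fun s => vphi (s ^+ 2)).

Definition metric1 (mu F : R) (rho : 'rV[R]_4 -> R) : 'rV[R]_4 -> 'M[R]_4 :=
  radial_metric rho
    (fun s => (1 + F * s ^- 4 - mu / 2 * s ^+ 2)^-1)
    (fun s => (1 + F * s ^- 4 - mu / 2 * s ^+ 2) * s ^+ 2)
    (fun s => s ^+ 2).

Definition Omega (mu E F s : R) : R :=
  let v := 1 + E * s ^+ 2 in
  s ^+ 4 /
  (v * (F * Num.sqrt v
        - E ^- 3 * (mu * v ^+ 2 - 2 * (2 * E + 3 * mu) * v
                    - (4 * E + 3 * mu)))).

(* Where this is a Riemannian metric the coefficients of drho^2 and sigma_1^2
   are positive, hence 1 + E s^2 > 0 there, and neither Num.sqrt nor an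
   inverse is evaluated at a junk value. *)
Definition metric2 (mu E F : R) (rho : 'rV[R]_4 -> R) : 'rV[R]_4 -> 'M[R]_4 :=
  radial_metric rho
    (Omega mu E F)
    (fun s => (1 + E * s ^+ 2)^-1 * (Omega mu E F s)^-1 * s ^+ 2)
    (fun s => s ^+ 2).

(* On the part of U with r in J, the metric g becomes one of the normal
   forms after the reparametrization r |-> h(r); h is a diffeomorphism of the
   interval J onto its image because h' has no zero. *)
Definition normalizable U (g : 'rV[R]_4 -> 'M[R]_4) (mu : R) (J : set R) :
    Prop :=
  exists h : R -> R,
  [/\ smooth_on J h,
      forall s, J s -> 0 < h s,
      forall s, J s -> derive1 h s != 0
    & (exists F : R, forall x, U x -> J (euclid_r x) ->
         g x = metric1 mu F (h \o euclid_r) x)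
      \/ (exists E F : R, E != 0 /\ forall x, U x -> J (euclid_r x) ->
         g x = metric2 mu E F (h \o euclid_r) x)].

End BianchiMetrics.

(* Main.v *)
(* With rho = |x|^2 and w = J x, where J is the complex structure of R^4 for
   which sigma1 is w / rho, the metric is A I + B x x^T + C w w^T with A, B, C
   functions of rho, because the sum of x x^T and of the rho^2 sigma_i^2 is
   rho I.  Its Ricci tensor keeps this shape, so that the Einstein equation
   amounts to three equations in P = psi, Q = phi, S = vphi.  Two combinations
   of them suffice.  The difference of the radial and sigma1 components,
   multiplied by S', says that
     E = rho S'^2 / (S P Q) - 1 / S
   is constant, and it excludes that S' = 0 on an interval.  The Hamiltonian
   constraint is of first order.  Where S' <> 0, S is a coordinate; E being
   constant, P is determined by Q and S, and the constraint is a linear equation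
   for Q as a function of S, whose integration constant is F.  The cases E = 0
   and E <> 0 give the two normal forms, with new radius sqrt S. *)
Require Import Defs.
From HB Require Import structures.
From mathcomp Require Import all_boot all_order all_algebra.
From mathcomp Require Import all_classical all_reals all_analysis.
From mathcomp Require Import ring.

Set Implicit Arguments.
Unset Strict Implicit.
Unset Printing Implicit Defensive.

Import Order.TTheory GRing.Theory Num.Theory.
Import numFieldNormedType.Exports.

Local Open Scope classical_set_scope.
Local Open Scope ring_scope.

(** * Case analysis over the four coordinates *)

Lemma sum4E (V : zmodType) (F : 'I_4 -> V) :
  \sum_i F i = F 0 + F 1 + F 2 + F 3.
Proof.
rewrite !big_ord_recl big_ord0 addr0 !addrA.
by congr (F _ + F _ + F _ + F _); apply: val_inj.
Qed.

(** The cases carry the same numerals as [sum4E], so that coordinates coming from either are the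
    same atoms for [ring]. *)
Lemma ord4_ind (P : 'I_4 -> Prop) : P 0 -> P 1 -> P 2 -> P 3 -> forall i, P i.
Proof.
move=> P0 P1 P2 P3 [[|[|[|[|//]]]] lti].
- by rewrite (_ : Ordinal _ = 0) //; apply: val_inj.
- by rewrite (_ : Ordinal _ = 1) //; apply: val_inj.
- by rewrite (_ : Ordinal _ = 2) //; apply: val_inj.
- by rewrite (_ : Ordinal _ = 3) //; apply: val_inj.
Qed.

(** * Rules for directional derivatives *)

Section DirectionalDerivatives.
Context {R : realType} {V : normedModType R}.
Implicit Types (f g : V -> R) (x v : V).

(* Not a class, unlike [is_derive]: applying a rule must not trigger an
   instance search for its premises. *)
Definition has_derive x v f (df : R) : Prop := is_derive x v f df.

Lemma has_derive_eq f x v df df' :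
  has_derive x v f df -> df = df' -> has_derive x v f df'.
Proof. by move=> fP <-. Qed.

Lemma has_derive_cst c x v : has_derive x v (fun=> c) 0.
Proof. exact: is_derive_cst. Qed.

(** The difference quotient along [v] is that of the restriction to a line, taken at 0. This brings
    the one-variable chain rule to [has_derive_comp]. *)
Lemma has_derive_line f x v df :
  has_derive x v f df <-> is_derive (0 : R) 1 (fun h : R => f (h *: v + x)) df.
Proof.
have E : 'D_v f x = 'D_1 (fun h : R => f (h *: v + x)) 0.
  rewrite /derive; set F := fun h => h^-1 *: _; set G := fun h => h^-1 *: _.
  suff -> : F = G by [].
  by apply/funext => h; rewrite /F /G /= addr0 scale0r add0r [_%:A]mulr1.
split=> -[fxv <-]; split.
- exact: (derivable1P f x v).1 fxv.
- exact: esym E.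
- exact: (derivable1P f x v).2 fxv.
- exact: E.
Qed.

Lemma has_deriveD f g x v df dg :
  has_derive x v f df -> has_derive x v g dg ->
  has_derive x v (fun y => f y + g y) (df + dg).
Proof. exact: is_deriveD. Qed.

Lemma has_deriveN f x v df :
  has_derive x v f df -> has_derive x v (fun y => - f y) (- df).
Proof. exact: is_deriveN. Qed.

Lemma has_deriveM f g x v df dg :
  has_derive x v f df -> has_derive x v g dg ->
  has_derive x v (fun y => f y * g y) (df * g x + f x * dg).
Proof.
move=> fx gx; apply: has_derive_eq (is_deriveM fx gx) _.
by rewrite addrC [df * _]mulrC.
Qed.

Lemma has_deriveX f n x v df : has_derive x v f df ->
  has_derive x v (fun y => f y ^+ n) (n%:R * f x ^+ n.-1 * df).
Proof. by move=> fx; have := is_deriveX n fx; rewrite exprfctE. Qed.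

Lemma has_deriveV f x v df : f x != 0 -> has_derive x v f df ->
  has_derive x v (fun y => (f y)^-1) (- df / f x ^+ 2).
Proof.
move=> fx0 [fv dfE]; apply: DeriveDef; first exact: derivableV.
by rewrite deriveV // dfE /GRing.scale /= mulNr mulrC mulNr.
Qed.

Lemma has_derive_comp (F : R -> R) f x v dF df :
  is_derive (f x) 1 F dF -> has_derive x v f df ->
  has_derive x v (fun y => F (f y)) (dF * df).
Proof.
move=> FP /has_derive_line fP; apply/has_derive_line.
by apply: is_derive1_comp; rewrite scale0r add0r.
Qed.

End DirectionalDerivatives.

Lemma has_derive_id (R : realType) (x : R) : has_derive x 1 (fun y => y) 1.
Proof. exact: is_derive_id. Qed.

Lemma has_derive_coord (R : realType) n (x v : 'rV[R]_n.+1) i :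
  has_derive x v (fun y => y 0 i) (v 0 i).
Proof.
have dx : derivable (fun y : 'rV[R]_n.+1 => y 0 i) x v.
  exact/diff_derivable/differentiable_coord.
apply: DeriveDef => //.
have := derive_mx (@derivable_id R _ x v).
by rewrite derive_id => /matrixP /(_ 0 i); rewrite mxE.
Qed.

(** Follows the syntax of the function and leaves the derivative to unification. Hypotheses come
    first, so a function whose derivative is in the context is kept whole; nonvanishing conditions
    that are not in the context remain as goals. *)
Ltac auto_has_derive := repeat first
  [ eassumption
  | apply: has_derive_cst
  | apply: has_derive_id
  | apply: has_derive_coord
  | apply: has_deriveD
  | apply: has_deriveN
  | apply: has_deriveM
  | apply: has_deriveX
  | apply: has_deriveV ].

(** * Algebra of the tensor shapes built from [x] and its rotation *)

Section Tensors.
Context {R : realType}.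
Implicit Types x : 'I_4 -> R.

Definition sqnorm x : R := \sum_i x i ^+ 2.

Definition kron (i j : 'I_4) : R := (i == j)%:R.

(* The covector field |x|^2 sigma1, as a linear vector field. *)
Definition rot x (i : 'I_4) : R := [:: x 1; - x 0; x 3; - x 2]`_i.

(** The Jacobian matrix of the linear field [rot], whose square is minus the identity. *)
Definition cplx (i j : 'I_4) : R := rot (kron j) i.

Definition bisym (a b c : R) x (i j : 'I_4) : R :=
  a * kron i j + b * (x i * x j) + c * (rot x i * rot x j).

(** The derivative of [bisym] in direction [m] with frozen coefficients. Coefficients depending on
    [|x|^2] add a further [bisym] with factor [2 x_m]. *)
Definition bisym_der (b c : R) x m (i j : 'I_4) : R :=
  b * (kron i m * x j + x i * kron j m)
  + c * (cplx i m * rot x j + rot x i * cplx j m).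

(* The shape of the Christoffel symbols Gamma^k_ij of a metric of shape
   [bisym]. *)
Definition gam (f a b c d e : R) x (k i j : 'I_4) : R :=
  f * (x i * kron j k + x j * kron i k) + a * (kron i j * x k)
  + b * (x i * x j * x k)
  + c * ((x i * rot x j + x j * rot x i) * rot x k)
  + d * (rot x i * rot x j * x k)
  + e * (rot x j * cplx k i + rot x i * cplx k j).

Definition gam_der (f a b c d e : R) x m (k i j : 'I_4) : R :=
  f * (kron i m * kron j k + kron j m * kron i k) + a * (kron i j * kron k m)
  + b * (kron i m * x j * x k + x i * kron j m * x k + x i * x j * kron k m)
  + c * ((kron i m * rot x j + x i * cplx j m + kron j m * rot x i
          + x j * cplx i m) * rot x k
         + (x i * rot x j + x j * rot x i) * cplx k m)
  + d * (cplx i m * rot x j * x k + rot x i * cplx j m * x k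
         + rot x i * rot x j * kron k m)
  + e * (cplx j m * cplx k i + cplx i m * cplx k j).

(** The components of [|x|^2 sigma2], of [x] and of [rot x] are mutually orthogonal eigenvectors of
    length [|x|]; contracting twice with each of them isolates one eigenvalue. *)
Lemma bisym0 (a b c : R) x : 0 < sqnorm x ->
  (forall i j, bisym a b c x i j = 0) ->
  [/\ a = 0, a + sqnorm x * b = 0 & a + sqnorm x * c = 0].
Proof.
move=> x0 abc0.
have contr (u : 'I_4 -> R) t :
    \sum_i \sum_j u i * u j * bisym a b c x i j = t * sqnorm x -> t = 0.
  rewrite big1; last by move=> i _; rewrite big1 // => j _; rewrite abc0 mulr0.
  by move/esym/eqP; rewrite mulf_eq0 (gt_eqF x0) orbF => /eqP.
split; [apply: (contr (fun i => [:: x 2; - x 3; - x 0; x 1]`_i))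
       |apply: (contr x)|apply: (contr (rot x))];
  by rewrite /sqnorm /bisym !sum4E /rot /kron /=; ring.
Qed.

(** Since [x] and [rot x] are orthogonal of equal length, the product of two such matrices has the
    same shape; the premises say that its coefficients are 1, 0 and 0. *)
Lemma bisym_inv (a b c ia ib ic : R) x :
  ia * a = 1 -> ia * b + ib * (a + sqnorm x * b) = 0 ->
  ia * c + ic * (a + sqnorm x * c) = 0 ->
  invmx (\matrix_(i, j) bisym a b c x i j) =
  \matrix_(i, j) bisym ia ib ic x i j.
Proof.
move=> aK bK cK.
have gK : (\matrix_(i, j) bisym a b c x i j) *m
    (\matrix_(i, j) bisym ia ib ic x i j) = 1%:M.
  apply/matrixP => i j; rewrite !mxE.
  under eq_bigr do rewrite !mxE.
  transitivity (bisym (ia * a) (ia * b + ib * (a + sqnorm x * b))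
                  (ia * c + ic * (a + sqnorm x * c)) x i j).
    rewrite /sqnorm !sum4E /bisym.
    by elim/ord4_ind: i; elim/ord4_ind: j; rewrite /rot /kron /=; ring.
  by rewrite aK bK cK /bisym !mul0r !addr0 mul1r.
have [gu _] := mulmx1_unit gK.
by rewrite -[RHS](mulKmx gu) gK mulmx1.
Qed.

(* [ix] and [iy] are the eigenvalues of the inverse metric on x and on
   [rot x]. *)
Lemma christoffel_contraction (ia ib ic a1 b c b1 c1 : R) x k i j
    (dg : 'I_4 -> 'I_4 -> 'I_4 -> R) :
  (forall m i j,
     dg m i j = 2 * x m * bisym a1 b1 c1 x i j + bisym_der b c x m i j) ->
  let ix := ia + sqnorm x * ib in let iy := ia + sqnorm x * ic in
  2^-1 * \sum_l bisym ia ib ic x k l * (dg i j l + dg j i l - dg l i j) =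
  gam (a1 * ia) ((b - a1) * ix) (b1 * ix + 2 * a1 * ib)
    (a1 * ic + c1 * iy + c * ic) (- c1 * ix - 2 * c * ib) (c * ia) x k i j.
Proof.
move=> dgE ix iy; rewrite {}/ix {}/iy.
have half (s t : R) : s = 2 * t -> 2^-1 * s = t.
  by move=> ->; rewrite mulKf // pnatr_eq0.
apply: half.
rewrite !sum4E !dgE /sqnorm sum4E /bisym /bisym_der /gam.
by elim/ord4_ind: i; elim/ord4_ind: j; elim/ord4_ind: k;
  rewrite /cplx /rot /kron /=; ring.
Qed.

(* T x is the trace of the Christoffel symbols, and T1 the derivative of T with
   respect to |x|^2. *)
Definition ricci_coeffs (f a b c d e f1 a1 b1 c1 d1 e1 r : R) : R * R * R :=
  let T := 5 * f + a + b * r + c * r + e in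
  let T1 := 5 * f1 + a1 + b1 * r + b + c1 * r + c + e1 in
  (2 * f + 4 * a + 2 * a1 * r - 2 * e - T + T * a * r - 2 * r * f * a,
   4 * f1 + 6 * b + 2 * b1 * r - 2 * c - 2 * T1 + T * (2 * f + b * r)
   - ((2 * f + a + b * r) ^+ 2 + (f + c * r + e) ^+ 2 + 2 * f ^+ 2 - 2 * f * a),
   2 * c + 6 * d + 2 * d1 * r - 4 * e1 + T * (d * r - 2 * e)
   - (2 * (a + d * r - 2 * e) * (f + c * r + e) - 2 * e ^+ 2 - 2 * f * a)).

(** With arrays [G] and [dG] in place of the Christoffel symbols and their derivatives, this is pure
    algebra: one polynomial identity for each of the sixteen pairs of indices. *)
Lemma ricci_contraction (f a b c d e f1 a1 b1 c1 d1 e1 : R) x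
    (G : 'I_4 -> 'I_4 -> 'I_4 -> R) (dG : 'I_4 -> 'I_4 -> 'I_4 -> 'I_4 -> R) :
  (forall k i j, G k i j = gam f a b c d e x k i j) ->
  (forall m k i j, dG m k i j = 2 * x m * gam f1 a1 b1 c1 d1 e1 x k i j
                                + gam_der f a b c d e x m k i j) ->
  let q := ricci_coeffs f a b c d e f1 a1 b1 c1 d1 e1 (sqnorm x) in
  forall i j, \sum_k dG k k i j - \sum_k dG j k i k
      + \sum_k \sum_l (G k k l * G l i j - G k j l * G l i k)
    = bisym q.1.1 q.1.2 q.2 x i j.
Proof.
move=> GE dGE q i j.
rewrite /q /ricci_coeffs {q} /sqnorm !sum4E !dGE !GE /bisym /gam /gam_der.
elim/ord4_ind: i; elim/ord4_ind: j; rewrite /cplx /rot /kron /=; ring.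
Qed.

End Tensors.

(* P, Q, S, r stand for psi, phi, vphi and |x|^2, a suffix 1 or 2 marks a
   derivative, and f, a, b, c, d, e are the coefficients of [gam] for the
   metric; p, m, k are the combinations 2f+a+br, f+cr+e and a+dr-2e that enter
   the Ricci tensor.  The first equation comes from R_00/P - R_11/Q in an
   adapted frame, the second from the 00-component of the Einstein tensor. *)
Lemma einstein_ode (R : realType) (r P P1 Q Q1 Q2 S S1 S2 P2 mu : R) :
  0 < r -> 0 < P -> 0 < Q -> 0 < S ->
  let f := S1 / S - r^-1 in
  let a := (1 - S1 / P) / r in
  let e := (Q / S - 1) / r in
  let p := P1 / P in
  let m := Q1 / Q - r^-1 in
  let k := (1 - Q1 / P) / r in
  let b := (p - 2 * f - a) / r in
  let c := (m - f - e) / r in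
  let d := (k - a + 2 * e) / r in
  let f1 := S2 / S - S1 ^+ 2 / S ^+ 2 + r ^- 2 in
  let a1 := - (S2 / P - S1 * P1 / P ^+ 2) / r - a / r in
  let e1 := (Q1 / S - Q * S1 / S ^+ 2) / r - e / r in
  let p1 := P2 / P - P1 ^+ 2 / P ^+ 2 in
  let m1 := Q2 / Q - Q1 ^+ 2 / Q ^+ 2 + r ^- 2 in
  let k1 := - (Q2 / P - Q1 * P1 / P ^+ 2) / r - k / r in
  let b1 := (p1 - 2 * f1 - a1 - b) / r in
  let c1 := (m1 - f1 - e1 - c) / r in
  let d1 := (k1 - a1 + 2 * e1 - d) / r in
  let q := ricci_coeffs f a b c d e f1 a1 b1 c1 d1 e1 r in
  q.1.1 = 3 * mu * (S / r) -> q.1.1 + r * q.1.2 = 3 * mu * P ->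
  q.1.1 + r * q.2 = 3 * mu * (Q / r) ->
  S1 + 2 * r * S2 - r * S1 * (S1 / S + P1 / P + Q1 / Q) + P * Q / S = 0 /\
  r * (2 * S1 * Q1 / (S * P * Q) + S1 ^+ 2 / (S ^+ 2 * P)) + Q / S ^+ 2 - 4 / S
    + 3 * mu = 0.
Proof.
move=> r0 P0 Q0 S0 f a e p m k b c d f1 a1 e1 p1 m1 k1 b1 c1 d1 q.
have [rn Pn Qn Sn] : [/\ r != 0, P != 0, Q != 0 & S != 0] by rewrite !gt_eqF.
have E1 : (q.1.1 + r * q.1.2) / P - r * (q.1.1 + r * q.2) / Q =
    - 2 / (S * P) * (S1 + 2 * r * S2 - r * S1 * (S1 / S + P1 / P + Q1 / Q)
                     + P * Q / S).
  rewrite /q /ricci_coeffs /= /d1 /c1 /b1 /k1 /m1 /p1 /e1 /a1 /f1.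
  rewrite /d /c /b /k /m /p /e /a /f.
  by field; rewrite Pn Qn Sn rn.
(* In the adapted frame this is [R_00/P - R_11/Q - 2 R_22/S], twice the radial component of the
   Einstein tensor; all second derivatives cancel in it. *)
have E2 : (q.1.1 + r * q.1.2) / P - r * (q.1.1 + r * q.2) / Q
      - 2 * r * q.1.1 / S =
    2 * (r * (2 * S1 * Q1 / (S * P * Q) + S1 ^+ 2 / (S ^+ 2 * P))
         + Q / S ^+ 2 - 4 / S).
  rewrite /q /ricci_coeffs /= /d1 /c1 /b1 /k1 /m1 /p1 /e1 /a1 /f1.
  rewrite /d /c /b /k /m /p /e /a /f.
  by field; rewrite Pn Qn Sn rn.
move=> qU qR qW; split.
  have : - 2 / (S * P) != 0.
    by rewrite mulf_neq0 ?invr_eq0 ?mulf_neq0 ?oppr_eq0 ?pnatr_eq0.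
  move=> /mulfI; apply; rewrite -E1 qR qW mulr0; field.
  by rewrite Pn Qn rn.
have two0 : 2 != 0 :> R by rewrite pnatr_eq0.
apply: (mulfI two0); rewrite mulrDr -E2 qR qW qU mulr0; field.
by rewrite Pn Qn Sn rn.
Qed.

(** * Christoffel symbols and Ricci tensor for coefficients depending on [|x|^2] *)

Section RadialCalculus.
Context {R : realType}.
Implicit Types x v : 'rV[R]_4.

Lemma delta_coord (m : 'I_4) : (delta_mx 0 m : 'rV[R]_4) 0 = kron m.
Proof.
by apply/funext => i; rewrite mxE /kron eq_sym.
Qed.

Lemma kronC (i j : 'I_4) : kron i j = kron j i :> R.
Proof. by rewrite /kron eq_sym. Qed.

Lemma has_derive_rot x v i :
  has_derive x v (fun y => rot (y 0) i) (rot (v 0) i).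
Proof.
by elim/ord4_ind: i; rewrite /rot /=; auto_has_derive.
Qed.

Lemma has_derive_sqnorm x v :
  has_derive x v (fun y => sqnorm (y 0)) (2 * \sum_i x 0 i * v 0 i).
Proof.
rewrite (_ : (fun y => _) =
  fun y : 'rV_4 => y 0 0 ^+ 2 + y 0 1 ^+ 2 + y 0 2 ^+ 2 + y 0 3 ^+ 2).
  by apply: has_derive_eq; [auto_has_derive|rewrite sum4E ; ring].
by apply/funext => y; rewrite /sqnorm sum4E.
Qed.

Lemma has_derive_radial (F : R -> R) x m dF :
  has_derive (sqnorm (x 0)) 1 F dF ->
  has_derive x (delta_mx 0 m) (fun y => F (sqnorm (y 0))) (2 * dF * x 0 m).
Proof.
move=> FP; apply: has_derive_eq.
  by apply: has_derive_comp FP (has_derive_sqnorm _ _).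
by rewrite delta_coord sum4E; elim/ord4_ind: m; rewrite /kron /=; ring.
Qed.

Lemma partialE (f : 'rV[R]_4 -> R) x m df :
  has_derive x (delta_mx 0 m) f df -> partial m f x = df.
Proof. by case. Qed.

Lemma partial_near (f g : 'rV[R]_4 -> R) x m :
  (\forall y \near x, f y = g y) -> partial m f x = partial m g x.
Proof. exact: near_eq_derive. Qed.

Lemma partial_bisym (a b c : R -> R) x m i j a1 b1 c1 :
  let r := sqnorm (x 0) in
  has_derive r 1 a a1 -> has_derive r 1 b b1 -> has_derive r 1 c c1 ->
  partial m (fun y => let s := sqnorm (y 0) in
      bisym (a s) (b s) (c s) (y 0) i j) x =
  2 * x 0 m * bisym a1 b1 c1 (x 0) i j + bisym_der (b r) (c r) (x 0) m i j.
Proof.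
move=> r /(has_derive_radial m) aP /(has_derive_radial m) bP.
move=> /(has_derive_radial m) cP.
have rP := has_derive_rot x (delta_mx 0 m).
rewrite /bisym; apply: partialE; apply: has_derive_eq; first by auto_has_derive.
rewrite /bisym_der /bisym /cplx !delta_coord !(kronC m) /r ; ring.
Qed.

Lemma partial_gam (f a b c d e : R -> R) x m k i j f1 a1 b1 c1 d1 e1 :
  let r := sqnorm (x 0) in
  has_derive r 1 f f1 -> has_derive r 1 a a1 -> has_derive r 1 b b1 ->
  has_derive r 1 c c1 -> has_derive r 1 d d1 -> has_derive r 1 e e1 ->
  partial m (fun y => let s := sqnorm (y 0) in
      gam (f s) (a s) (b s) (c s) (d s) (e s) (y 0) k i j) x =
  2 * x 0 m * gam f1 a1 b1 c1 d1 e1 (x 0) k i j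
  + gam_der (f r) (a r) (b r) (c r) (d r) (e r) (x 0) m k i j.
Proof.
move=> r /(has_derive_radial m) fP /(has_derive_radial m) aP.
move=> /(has_derive_radial m) bP /(has_derive_radial m) cP.
move=> /(has_derive_radial m) dP /(has_derive_radial m) eP.
have rP := has_derive_rot x (delta_mx 0 m).
rewrite /gam; apply: partialE; apply: has_derive_eq; first by auto_has_derive.
rewrite /gam_der /gam /cplx !delta_coord !(kronC m) /r ; ring.
Qed.

(** The inverse metric enters undifferentiated, so [ia], [ib], [ic] are mere numbers at the point
    [x], whereas [g] has to be known near [x]. *)
Lemma christoffel_bisym (g : 'rV[R]_4 -> 'M[R]_4) (a b c : R -> R) x
    a1 b1 c1 ia ib ic :
  let r := sqnorm (x 0) in
  (\forall y \near x, g y = let s := sqnorm (y 0) in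
     \matrix_(i, j) bisym (a s) (b s) (c s) (y 0) i j) ->
  has_derive r 1 a a1 -> has_derive r 1 b b1 -> has_derive r 1 c c1 ->
  ia * a r = 1 -> ia * b r + ib * (a r + r * b r) = 0 ->
  ia * c r + ic * (a r + r * c r) = 0 ->
  let ix := ia + r * ib in let iy := ia + r * ic in
  forall k i j, christoffel g k i j x =
    gam (a1 * ia) ((b r - a1) * ix) (b1 * ix + 2 * a1 * ib)
      (a1 * ic + c1 * iy + c r * ic) (- c1 * ix - 2 * c r * ib) (c r * ia)
      (x 0) k i j.
Proof.
move=> r gE aP bP cP aK bK cK ix iy k i j.
have gx := nbhs_singleton gE; rewrite /= in gx.
pose dg m i j := partial m (fun y => g y i j) x.
rewrite /christoffel gx (bisym_inv aK bK cK).
under eq_bigr do rewrite mxE.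
apply: (christoffel_contraction ia ib ic k i j (dg := dg)) => m {}i {}j.
rewrite /dg -(partial_bisym _ _ _ aP bP cP).
by apply: partial_near; apply: filterS gE => y ->; rewrite mxE.
Qed.

Lemma ricci_gam (g : 'rV[R]_4 -> 'M[R]_4) (f a b c d e : R -> R) x
    f1 a1 b1 c1 d1 e1 :
  let r := sqnorm (x 0) in
  (\forall y \near x, forall k i j,
     christoffel g k i j y = let s := sqnorm (y 0) in
     gam (f s) (a s) (b s) (c s) (d s) (e s) (y 0) k i j) ->
  has_derive r 1 f f1 -> has_derive r 1 a a1 -> has_derive r 1 b b1 ->
  has_derive r 1 c c1 -> has_derive r 1 d d1 -> has_derive r 1 e e1 ->
  let q := ricci_coeffs (f r) (a r) (b r) (c r) (d r) (e r)
                         f1 a1 b1 c1 d1 e1 r in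
  forall i j, ricci g x i j = bisym q.1.1 q.1.2 q.2 (x 0) i j.
Proof.
move=> r gE fP aP bP cP dP eP q i j; rewrite mxE.
apply: (ricci_contraction (G := fun k i j => christoffel g k i j x)
          (dG := fun m k i j => partial m (christoffel g k i j) x)).
  by have gx := nbhs_singleton gE => k {}i {}j; exact: gx.
move=> m k {}i {}j; rewrite -(partial_gam _ _ _ _ fP aP bP cP dP eP).
by apply: partial_near; apply: filterS gE => y ->.
Qed.

End RadialCalculus.

(** * The metric in Cartesian coordinates *)

Section BianchiEinstein.
Context {R : realType}.
Implicit Types x : 'rV[R]_4.

Lemma euclid_r_sqr x : euclid_r x ^+ 2 = sqnorm (x 0).
Proof. by rewrite sqr_sqrtr // sumr_ge0 // => i _; exact: sqr_ge0. Qed.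

Lemma sqnorm_gt0 x : x != 0 -> 0 < sqnorm (x 0).
Proof.
move=> x0; rewrite lt_neqAle sumr_ge0 ?andbT; last first.
  by move=> i _; exact: sqr_ge0.
apply: contra x0; rewrite eq_sym psumr_eq0; last by move=> i _; exact: sqr_ge0.
move=> /allP x0; apply/eqP/rowP => i; rewrite mxE.
by have := x0 i (mem_index_enum i); rewrite /= sqrf_eq0 => /eqP.
Qed.

Lemma euclid_r_gt0 x : x != 0 -> 0 < euclid_r x.
Proof. by move=> /sqnorm_gt0; rewrite /euclid_r sqrtr_gt0. Qed.

Lemma partial_comp_euclid_r (h : R -> R) x k dh : x != 0 ->
  has_derive (euclid_r x) 1 h dh ->
  partial k (h \o euclid_r) x = dh * (x 0 k / euclid_r x).
Proof.
move=> x0 hP; apply: partialE.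
have rP : has_derive x (delta_mx 0 k) euclid_r (x 0 k / euclid_r x).
  have sqrtP := is_derive1_sqrt (sqnorm_gt0 x0).
  apply: has_derive_eq (has_derive_radial k sqrtP) _.
  rewrite -/(euclid_r x); field.
  by rewrite gt_eqF // euclid_r_gt0.
exact: has_derive_comp.
Qed.

Lemma dform_comp_euclid_r (h : R -> R) x dh : x != 0 ->
  has_derive (euclid_r x) 1 h dh ->
  dform (h \o euclid_r) x = dh *: dform euclid_r x.
Proof.
move=> x0 hP; apply/rowP => k; rewrite !mxE (partial_comp_euclid_r _ x0 hP).
by rewrite (partial_comp_euclid_r k x0 (has_derive_id _)) mul1r.
Qed.

Lemma sqformE n (w : 'rV[R]_n.+1) i j : sqform w i j = w 0 i * w 0 j.
Proof. by rewrite !mxE big_ord1 !mxE. Qed.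

Lemma bianchi_metricE (psi phi vphi : R -> R) x : x != 0 ->
  bianchi_metric psi phi vphi x = let s := sqnorm (x 0) in
  \matrix_(i, j) bisym (vphi s / s) ((psi s - vphi s / s) / s)
                   ((phi s - vphi s) / s ^+ 2) (x 0) i j.
Proof.
move=> x0 /=; have s0 : sqnorm (x 0) != 0 by rewrite gt_eqF ?sqnorm_gt0.
have drE i : dform euclid_r x 0 i = x 0 i / euclid_r x.
  by rewrite mxE (partial_comp_euclid_r i x0 (has_derive_id _)) mul1r.
(* Only products of two entries of [dr] occur, so the square root in [euclid_r] disappears. *)
have drr i j : dform euclid_r x 0 i * dform euclid_r x 0 j =
    x 0 i * x 0 j / sqnorm (x 0).
  by rewrite !drE -euclid_r_sqr expr2 invfM; ring.
apply/matrixP => i j; rewrite /bianchi_metric /radial_metric euclid_r_sqr.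
have addE (A B : 'M[R]_4) : (A + B) i j = A i j + B i j by rewrite mxE.
have scaleE c (A : 'M[R]_4) : (c *: A) i j = c * A i j by rewrite mxE.
rewrite !(addE, scaleE) !sqformE drr; clear addE scaleE.
rewrite /sigma1 /sigma2 /sigma3 euclid_r_sqr !mxE.
move: s0; rewrite /bisym /kron /rot.
move: (psi _) (phi _) (vphi _) => P Q S.
rewrite /sqnorm sum4E.
by elim/ord4_ind: i; elim/ord4_ind: j => s0 /=; field.
Qed.

End BianchiEinstein.

(** * From the Einstein equation to ordinary differential equations *)

Section BianchiRicci.
Context {R : realType}.
Implicit Types (x : 'rV[R]_4) (U : set 'rV[R]_4) (A : set R) (f : R -> R).

Lemma smooth_on_has_derive A f t :
  smooth_on A f -> A t -> has_derive t 1 f (derive1 f t).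
Proof.
by move=> fA At; rewrite derive1E; apply: derivableP; exact: (fA 0%N).
Qed.

Lemma smooth_on_derive1 A f : smooth_on A f -> smooth_on A (derive1 f).
Proof. by move=> fA m t At; rewrite -derive1Sn; exact: (fA m.+1). Qed.

Variables (U : set 'rV[R]_4) (psi phi vphi : R -> R) (mu : R).
Hypotheses (Uopen : open U) (U0 : ~ U 0).
Let D := [set euclid_r x ^+ 2 | x in U].
Hypotheses (psiC : smooth_on D psi) (phiC : smooth_on D phi)
  (vphiC : smooth_on D vphi).
Hypothesis psi0 : forall x, U x -> 0 < psi (euclid_r x ^+ 2).
Hypothesis phi0 : forall x, U x -> 0 < phi (euclid_r x ^+ 2).
Hypothesis vphi0 : forall x, U x -> 0 < vphi (euclid_r x ^+ 2).

(** The coefficients of [gam] for the metric. Three of them are solved from [cp = 2 cf + ca + s cb],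
    [cm = cf + s cc + ce] and [ck = ca + s cd - 2 ce], whose left-hand sides are short. *)
Let cf (s : R) : R := derive1 vphi s / vphi s - s^-1.
Let ca (s : R) : R := (1 - derive1 vphi s / psi s) / s.
Let ce (s : R) : R := (phi s / vphi s - 1) / s.
Let cp (s : R) : R := derive1 psi s / psi s.
Let cm (s : R) : R := derive1 phi s / phi s - s^-1.
Let ck (s : R) : R := (1 - derive1 phi s / psi s) / s.
Let cb (s : R) : R := (cp s - 2 * cf s - ca s) / s.
Let cc (s : R) : R := (cm s - cf s - ce s) / s.
Let cd (s : R) : R := (ck s - ca s + 2 * ce s) / s.

Lemma mem_neq0 x : U x -> x != 0.
Proof. by move=> Ux; apply/eqP => x0; rewrite x0 in Ux. Qed.

Lemma bianchi_data x : U x -> let s := sqnorm (x 0) in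
  [/\ D s, s != 0, psi s != 0, phi s != 0 & vphi s != 0].
Proof.
move=> Ux s; rewrite /s -euclid_r_sqr; split; rewrite ?gt_eqF; auto.
- by exists x.
- by rewrite exprn_gt0 // euclid_r_gt0 // mem_neq0.
Qed.

Lemma christoffel_bianchi x k i j : U x ->
  christoffel (bianchi_metric psi phi vphi) k i j x = let s := sqnorm (x 0) in
  gam (cf s) (ca s) (cb s) (cc s) (cd s) (ce s) (x 0) k i j.
Proof.
move=> Ux; have [Ds s0 P0 Q0 S0] := bianchi_data Ux.
have P1 := smooth_on_has_derive psiC Ds.
have Q1 := smooth_on_has_derive phiC Ds.
have S1 := smooth_on_has_derive vphiC Ds.
set s := sqnorm (x 0) in Ds s0 P0 Q0 S0 P1 Q1 S1 *.
pose A (t : R) : R := vphi t / t.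
pose B (t : R) : R := (psi t - vphi t / t) / t.
pose C (t : R) : R := (phi t - vphi t) / t ^+ 2.
have gE : \forall y \near x, bianchi_metric psi phi vphi y =
    let t := sqnorm (y 0) in
    \matrix_(i, j) bisym (A t) (B t) (C t) (y 0) i j.
  have := open_nbhs_nbhs (conj Uopen Ux); apply: filterS => y Uy.
  exact: bianchi_metricE (mem_neq0 Uy).
have AP : has_derive s 1 A ((derive1 vphi s - vphi s / s) / s).
  rewrite /A; apply: has_derive_eq; first by auto_has_derive.
  by rewrite /=; field.
have BP : has_derive s 1 B
    ((derive1 psi s - (derive1 vphi s - vphi s / s) / s) / s
     - (psi s - vphi s / s) / s ^+ 2).
  rewrite /B; apply: has_derive_eq; first by auto_has_derive.
  by rewrite /=; field.
have CP : has_derive s 1 C ((derive1 phi s - derive1 vphi s) / s ^+ 2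
    - 2 * (phi s - vphi s) / s ^+ 3).
  rewrite /C; apply: has_derive_eq.
    by auto_has_derive; rewrite expf_neq0.
  by rewrite /=; field.
(* The inverse metric has the eigenvalues [s / vphi], [1 / psi] and [s / phi], which determine its
   three coefficients. *)
have AK : s / vphi s * A s = 1 by rewrite /A; field; rewrite ?s0 ?S0.
have BK :
    s / vphi s * B s + ((psi s)^-1 - s / vphi s) / s * (A s + s * B s) = 0.
  by rewrite /A /B; field; rewrite ?s0 ?P0 ?S0.
have CK : s / vphi s * C s + ((phi s)^-1 - (vphi s)^-1) * (A s + s * C s) = 0.
  by rewrite /A /C; field; rewrite ?s0 ?Q0 ?S0.
rewrite (christoffel_bisym gE AP BP CP AK BK CK) /= -/s.
rewrite /A /B /C /cf /ca /cb /cc /cd /ce /ck /cm /cp /cf /ca /ce.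
by congr gam; field; rewrite ?s0 ?P0 ?Q0 ?S0.
Qed.

Lemma einstein_bianchi_ode x :
  einstein U (bianchi_metric psi phi vphi) mu -> U x ->
  let r := euclid_r x ^+ 2 in
  let P := psi r in let Q := phi r in let S := vphi r in
  let P1 := derive1 psi r in let Q1 := derive1 phi r in
  let S1 := derive1 vphi r in let S2 := derive1 (derive1 vphi) r in
  S1 + 2 * r * S2 - r * S1 * (S1 / S + P1 / P + Q1 / Q) + P * Q / S = 0 /\
  r * (2 * S1 * Q1 / (S * P * Q) + S1 ^+ 2 / (S ^+ 2 * P)) + Q / S ^+ 2 - 4 / S
    + 3 * mu = 0.
Proof.
move=> ein Ux; rewrite /= euclid_r_sqr.
have [Ds r0 P0 Q0 S0] := bianchi_data Ux.
set r := sqnorm (x 0) in Ds r0 P0 Q0 S0 *.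
have rgt0 : 0 < r by rewrite /r sqnorm_gt0 // mem_neq0.
have P1 := smooth_on_has_derive psiC Ds.
have Q1 := smooth_on_has_derive phiC Ds.
have S1 := smooth_on_has_derive vphiC Ds.
have P2 := smooth_on_has_derive (smooth_on_derive1 psiC) Ds.
have Q2 := smooth_on_has_derive (smooth_on_derive1 phiC) Ds.
have S2 := smooth_on_has_derive (smooth_on_derive1 vphiC) Ds.
pose f1 : R := derive1 (derive1 vphi) r / vphi r
  - derive1 vphi r ^+ 2 / vphi r ^+ 2 + r ^- 2.
pose a1 : R := - (derive1 (derive1 vphi) r / psi r
  - derive1 vphi r * derive1 psi r / psi r ^+ 2) / r - ca r / r.
pose e1 : R := (derive1 phi r / vphi r
  - phi r * derive1 vphi r / vphi r ^+ 2) / r - ce r / r.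
pose p1 : R := derive1 (derive1 psi) r / psi r
  - derive1 psi r ^+ 2 / psi r ^+ 2.
pose m1 : R := derive1 (derive1 phi) r / phi r
  - derive1 phi r ^+ 2 / phi r ^+ 2 + r ^- 2.
pose k1 : R := - (derive1 (derive1 phi) r / psi r
  - derive1 phi r * derive1 psi r / psi r ^+ 2) / r - ck r / r.
pose b1 : R := (p1 - 2 * f1 - a1 - cb r) / r.
pose c1 : R := (m1 - f1 - e1 - cc r) / r.
pose d1 : R := (k1 - a1 + 2 * e1 - cd r) / r.
have fP : has_derive r 1 cf f1.
  rewrite /cf; apply: has_derive_eq; first by auto_has_derive.
  by rewrite /f1 /=; field; rewrite ?r0 ?S0.
have aP : has_derive r 1 ca a1.
  rewrite /ca; apply: has_derive_eq; first by auto_has_derive.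
  by rewrite /a1 /ca /=; field; rewrite ?r0 ?P0.
have eP : has_derive r 1 ce e1.
  rewrite /ce; apply: has_derive_eq; first by auto_has_derive.
  by rewrite /e1 /ce /=; field; rewrite ?r0 ?S0.
have pP : has_derive r 1 cp p1.
  rewrite /cp; apply: has_derive_eq; first by auto_has_derive.
  by rewrite /p1 /=; field; rewrite ?r0 ?P0.
have mP : has_derive r 1 cm m1.
  rewrite /cm; apply: has_derive_eq; first by auto_has_derive.
  by rewrite /m1 /=; field; rewrite ?r0 ?Q0.
have kP : has_derive r 1 ck k1.
  rewrite /ck; apply: has_derive_eq; first by auto_has_derive.
  by rewrite /k1 /ck /=; field; rewrite ?r0 ?P0.
have bP : has_derive r 1 cb b1.
  rewrite /cb; apply: has_derive_eq; first by auto_has_derive.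
  by rewrite /b1 /cb /=; field; rewrite ?r0.
have cP : has_derive r 1 cc c1.
  rewrite /cc; apply: has_derive_eq; first by auto_has_derive.
  by rewrite /c1 /cc /=; field; rewrite ?r0.
have dP : has_derive r 1 cd d1.
  rewrite /cd; apply: has_derive_eq; first by auto_has_derive.
  by rewrite /d1 /cd /=; field; rewrite ?r0.
have gE : \forall y \near x, forall k i j,
    christoffel (bianchi_metric psi phi vphi) k i j y = let s := sqnorm (y 0) in
    gam (cf s) (ca s) (cb s) (cc s) (cd s) (ce s) (y 0) k i j.
  have := open_nbhs_nbhs (conj Uopen Ux); apply: filterS => y Uy k i j.
  exact: christoffel_bianchi.
pose q := ricci_coeffs (cf r) (ca r) (cb r) (cc r) (cd r) (ce r)
  f1 a1 b1 c1 d1 e1 r.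
have ricE i j : ricci (bianchi_metric psi phi vphi) x i j =
    bisym q.1.1 q.1.2 q.2 (x 0) i j.
  exact: ricci_gam gE fP aP bP cP dP eP i j.
(* The Ricci tensor minus [3 mu g] has the shape [bisym] and is zero, so its three eigenvalues
   vanish. *)
have /(bisym0 rgt0)[qU qR qW] : forall i j,
    bisym (q.1.1 - 3 * mu * (vphi r / r))
      (q.1.2 - 3 * mu * ((psi r - vphi r / r) / r))
      (q.2 - 3 * mu * ((phi r - vphi r) / r ^+ 2)) (x 0) i j = 0.
  move=> i j; have := congr1 (fun M : 'M[R]_4 => M i j) (ein x Ux).
  rewrite ricE mxE (bianchi_metricE _ _ _ (mem_neq0 Ux)) mxE -/r => E.
  transitivity (bisym q.1.1 q.1.2 q.2 (x 0) i j - 3 * mu * bisym (vphi r / r)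
      ((psi r - vphi r / r) / r) ((phi r - vphi r) / r ^+ 2) (x 0) i j).
    by rewrite /bisym; ring.
  by rewrite E subrr.
have [Pp Qp Sp] : [/\ 0 < psi r, 0 < phi r & 0 < vphi r].
  by rewrite /r -euclid_r_sqr psi0 ?phi0 ?vphi0.
apply: (einstein_ode (P2 := derive1 (derive1 psi) r)
  (Q2 := derive1 (derive1 phi) r) rgt0 Pp Qp Sp).
- exact: subr0_eq qU.
- rewrite -/q; apply: subr0_eq; rewrite -[RHS]qR; rewrite -/r; field.
  by rewrite r0.
- rewrite -/q; apply: subr0_eq; rewrite -[RHS]qW; rewrite -/r; field.
  by rewrite r0.
Qed.

End BianchiRicci.

(** * Closure properties of smooth functions of one variable *)

Section Smoothness.
Context {R : realType}.
Implicit Types (A B J : set R) (f g : R -> R).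

(** Differentiability [n] times: a finite order, on which the closure rules can be proved by
    induction. *)
Definition diff_upto n A f :=
  forall m t, (m < n)%N -> A t -> derivable (derive1n m f) t 1.

Lemma smooth_onP A f : smooth_on A f <-> forall n, diff_upto n A f.
Proof.
split=> [fA n m t _|fA m t]; first exact: fA.
exact: (fA m.+1 m t (ltnSn m)).
Qed.

Lemma diff_upto0 A f : diff_upto 0 A f.
Proof. by move=> m t; rewrite ltn0. Qed.

Lemma diff_uptoW n A f : diff_upto n.+1 A f -> diff_upto n A f.
Proof. by move=> fA m t mn; apply: fA; rewrite ltnS ltnW. Qed.

Lemma diff_upto_derive n A f t : diff_upto n.+1 A f -> A t ->
  has_derive t 1 f (derive1 f t).
Proof.
by move=> fA At; rewrite derive1E; apply: derivableP; exact: (fA 0%N).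
Qed.

Lemma diff_upto_derive1 n A f : diff_upto n.+1 A f -> diff_upto n A (derive1 f).
Proof. by move=> fA m t mn At; rewrite -derive1Sn; apply: fA. Qed.

Lemma derive1n_eq A f g m t : open A -> {in A, f =1 g} -> A t ->
  derive1n m f t = derive1n m g t.
Proof.
move=> Ao fg; elim: m t => [|m IHm] t At; first by apply: fg; rewrite inE.
rewrite !derive1nS !derive1E; apply: near_eq_derive.
have := open_nbhs_nbhs (conj Ao At); apply: filterS => y; exact: IHm.
Qed.

(** On an open set a formula [df] for the derivative has the same iterated derivatives as
    [derive1 f]. The inductions below use this to pass from order [n] of the formula to order [n.+1]
    of the function. *)
Lemma diff_upto_step n A f df : open A ->
  (forall t, A t -> has_derive t 1 f (df t)) -> diff_upto n A df ->
  diff_upto n.+1 A f.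
Proof.
move=> Ao fP dfA [|m] t mn At; first by have [] := fP t At.
rewrite derive1Sn; apply: near_eq_derivable (dfA m t mn At).
have := open_nbhs_nbhs (conj Ao At); apply: filterS => y Ay.
apply: (derive1n_eq (A := A)) => // z; rewrite inE derive1E => Az.
by have [_ ->] := fP z Az.
Qed.

Lemma diff_upto_cst n A c : open A -> diff_upto n A (fun=> c).
Proof.
move=> Ao; elim: n c => [c|n IHn c]; first exact: diff_upto0.
by apply: (diff_upto_step Ao _ (IHn 0)) => t _; exact: has_derive_cst.
Qed.

Lemma diff_upto_id n A : open A -> diff_upto n A (fun t => t).
Proof.
move=> Ao; case: n => [|n]; first exact: diff_upto0.
apply: (diff_upto_step Ao (df := fun=> 1)).
  by move=> t _; exact: has_derive_id.
exact: diff_upto_cst.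
Qed.

Lemma diff_uptoD n A f g : open A -> diff_upto n A f -> diff_upto n A g ->
  diff_upto n A (fun t => f t + g t).
Proof.
move=> Ao; elim: n f g => [f g _ _|n IHn f g fA gA]; first exact: diff_upto0.
apply: (diff_upto_step Ao (df := fun t => derive1 f t + derive1 g t)).
  move=> t At; apply: has_deriveD.
    exact: diff_upto_derive fA At.
  exact: diff_upto_derive gA At.
by apply: IHn; exact: diff_upto_derive1.
Qed.

Lemma diff_uptoM n A f g : open A -> diff_upto n A f -> diff_upto n A g ->
  diff_upto n A (fun t => f t * g t).
Proof.
move=> Ao; elim: n f g => [f g _ _|n IHn f g fA gA]; first exact: diff_upto0.
apply: (diff_upto_step Ao
  (df := fun t => derive1 f t * g t + f t * derive1 g t)).
  move=> t At; apply: has_deriveM.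
    exact: diff_upto_derive fA At.
  exact: diff_upto_derive gA At.
have f1A := diff_upto_derive1 fA; have g1A := diff_upto_derive1 gA.
apply: (diff_uptoD Ao).
  by apply: IHn => [|]; [exact: f1A|exact: diff_uptoW].
by apply: IHn => [|]; [exact: diff_uptoW|exact: g1A].
Qed.

Lemma diff_uptoV n A f : open A -> (forall t, A t -> f t != 0) ->
  diff_upto n A f -> diff_upto n A (fun t => (f t)^-1).
Proof.
move=> Ao f0; elim: n => [_|n IHn fA]; first exact: diff_upto0.
(* The derivative is written as a pure product, so that the induction hypothesis and the product
   rule suffice. *)
apply: (diff_upto_step Ao
  (df := fun t => - 1 * (derive1 f t * ((f t)^-1 * (f t)^-1)))).
  move=> t At; apply: has_derive_eq.
    by apply: has_deriveV (f0 t At) (diff_upto_derive fA At).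
  by field; exact: f0.
have fVA := IHn (diff_uptoW fA); have f1A := diff_upto_derive1 fA.
apply: (diff_uptoM (f := fun=> - 1) Ao); first exact: diff_upto_cst.
exact: (diff_uptoM Ao f1A (diff_uptoM Ao fVA fVA)).
Qed.

Lemma diff_upto_comp n A B f g : open A -> (forall t, A t -> B (g t)) ->
  diff_upto n B f -> diff_upto n A g -> diff_upto n A (fun t => f (g t)).
Proof.
move=> Ao AB; elim: n f => [f _ _|n IHn f fB gA]; first exact: diff_upto0.
apply: (diff_upto_step Ao (df := fun t => derive1 f (g t) * derive1 g t)).
  move=> t At; apply: has_derive_comp; last exact: diff_upto_derive gA At.
  exact: diff_upto_derive fB (AB t At).
apply: (diff_uptoM Ao); last exact: diff_upto_derive1.
by apply: IHn; [exact: diff_upto_derive1|exact: diff_uptoW].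
Qed.

Lemma diff_upto_sqrt n A f : open A -> (forall t, A t -> 0 < f t) ->
  diff_upto n A f -> diff_upto n A (fun t => Num.sqrt (f t)).
Proof.
move=> Ao f0; elim: n => [_|n IHn fA]; first exact: diff_upto0.
apply: (diff_upto_step Ao
  (df := fun t => derive1 f t * (2 * Num.sqrt (f t))^-1)).
  move=> t At; rewrite mulrC; apply: has_derive_comp.
    by apply: is_derive1_sqrt; exact: f0.
  exact: diff_upto_derive fA At.
have sA := IHn (diff_uptoW fA); have f1A := diff_upto_derive1 fA.
apply: (diff_uptoM Ao f1A); apply: (diff_uptoV Ao).
  by move=> t At; rewrite mulf_neq0 ?pnatr_eq0 // gt_eqF // sqrtr_gt0 f0.
apply: (diff_uptoM (f := fun=> 2) Ao); last exact: sA.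
exact: diff_upto_cst.
Qed.

Lemma smooth_on_sqrt_sqr A B f : open A -> (forall t, A t -> B (t ^+ 2)) ->
  smooth_on B f -> (forall t, A t -> 0 < f (t ^+ 2)) ->
  smooth_on A (fun t => Num.sqrt (f (t ^+ 2))).
Proof.
move=> Ao AB /smooth_onP fB f0; apply/smooth_onP => n.
apply: (diff_upto_sqrt Ao f0); apply: (diff_upto_comp Ao AB (fB n)).
by apply: (diff_uptoM (f := fun t => t) (g := fun t => t) Ao);
  exact: diff_upto_id.
Qed.

Lemma has_derive0_cst J f s t : is_interval J ->
  (forall u, J u -> has_derive u 1 f 0) -> J s -> J t -> f s = f t.
Proof.
move=> Ji fP; wlog st : s t / s <= t => [wl|Js Jt].
  by case: (leP s t) => [/wl //|/ltW ts Js Jt]; apply/esym/wl.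
have sub u : u \in `[s, t] -> J u by rewrite in_itv; exact: Ji.
have fc : {within `[s, t]%classic, continuous f}.
  by apply: derivable_within_continuous => u /sub /fP[].
have [u _] := MVT_segment st
  (fun u (ust : u \in `]s, t[) => fP u (sub u (subset_itv_oo_cc ust))) fc.
by rewrite mul0r => /subr0_eq.
Qed.

End Smoothness.

(** * Change of radius, first integrals and the two normal forms *)

Lemma sqform_scale (R : realType) n c (w : 'rV[R]_n.+1) :
  sqform (c *: w) = c ^+ 2 *: sqform w.
Proof. by apply/matrixP => i j; rewrite [RHS]mxE !sqformE !mxE; ring. Qed.

(** Only the [drho^2] term feels the change of radius, through [drho = h' dr]; the forms [sigma_i]
    are the same on both sides. *)
Lemma bianchi_reparam (R : realType) (psi phi vphi h P Q S : R -> R)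
    (x : 'rV[R]_4) dh : x != 0 -> has_derive (euclid_r x) 1 h dh ->
  let s := euclid_r x in
  psi (s ^+ 2) = P (h s) * dh ^+ 2 -> phi (s ^+ 2) = Q (h s) ->
  vphi (s ^+ 2) = S (h s) ->
  bianchi_metric psi phi vphi x = radial_metric (h \o euclid_r) P Q S x.
Proof.
move=> x0 hP /= PE QE SE; rewrite /bianchi_metric /radial_metric.
by rewrite PE QE SE (dform_comp_euclid_r x0 hP) sqform_scale scalerA.
Qed.

Section NormalForms.
Context {R : realType}.
Variables (U : set 'rV[R]_4) (psi phi vphi : R -> R) (mu : R) (J : set R).
Hypotheses (U0 : ~ U 0) (JU : J `<=` [set euclid_r x | x in U]).
Let D := [set euclid_r x ^+ 2 | x in U].
Hypotheses (psiC : smooth_on D psi) (phiC : smooth_on D phi)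
  (vphiC : smooth_on D vphi).
Hypothesis psi0 : forall x, U x -> 0 < psi (euclid_r x ^+ 2).
Hypothesis phi0 : forall x, U x -> 0 < phi (euclid_r x ^+ 2).
Hypothesis vphi0 : forall x, U x -> 0 < vphi (euclid_r x ^+ 2).
Hypothesis Uopen : open U.
Hypothesis ein : einstein U (bianchi_metric psi phi vphi) mu.

(** From here on [s] is the radius itself, while [P1], [Q1], [S1], [S2] are derivatives with respect
    to [s^2]; the chain rule therefore produces factors [2 s]. *)
Let P s := psi (s ^+ 2).
Let Q s := phi (s ^+ 2).
Let S s := vphi (s ^+ 2).
Let P1 s := derive1 psi (s ^+ 2).
Let Q1 s := derive1 phi (s ^+ 2).
Let S1 s := derive1 vphi (s ^+ 2).
Let S2 s := derive1 (derive1 vphi) (s ^+ 2).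

Lemma radius_gt0 s : J s -> 0 < s.
Proof. by move=> /JU[x Ux <-]; apply: euclid_r_gt0; exact: mem_neq0 Ux. Qed.

Lemma coeffs_gt0 s : J s -> [/\ 0 < P s, 0 < Q s & 0 < S s].
Proof. by move=> /JU[x Ux <-]; rewrite /P /Q /S psi0 ?phi0 ?vphi0. Qed.

Lemma coeffs_neq0 s : J s -> [/\ P s != 0, Q s != 0 & S s != 0].
Proof. by move=> /coeffs_gt0[? ? ?]; rewrite !gt_eqF. Qed.

Lemma has_derive_sqr f s : smooth_on D f -> J s ->
  has_derive s 1 (fun t => f (t ^+ 2)) (derive1 f (s ^+ 2) * (2 * s)).
Proof.
move=> fC /JU[x Ux xs]; apply: has_derive_comp.
  by apply: smooth_on_has_derive fC _; exists x => //; rewrite xs.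
by apply: has_derive_eq; [auto_has_derive|rewrite /=; ring].
Qed.

Lemma radial_ode s : J s ->
  S1 s + 2 * s ^+ 2 * S2 s
    - s ^+ 2 * S1 s * (S1 s / S s + P1 s / P s + Q1 s / Q s)
    + P s * Q s / S s = 0 /\
  s ^+ 2 * (2 * S1 s * Q1 s / (S s * P s * Q s) + S1 s ^+ 2 / (S s ^+ 2 * P s))
    + Q s / S s ^+ 2 - 4 / S s + 3 * mu = 0.
Proof.
move=> /JU[x Ux <-].
exact: (einstein_bianchi_ode Uopen U0 psiC phiC vphiC psi0 phi0 vphi0 ein Ux).
Qed.

Lemma has_derive_invariant s : J s -> has_derive s 1
  (fun t => t ^+ 2 * S1 t ^+ 2 / (S t * P t * Q t) - (S t)^-1) 0.
Proof.
move=> Js; have [ode _] := radial_ode Js.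
have [Pn Qn Sn] := coeffs_neq0 Js.
have PP := has_derive_sqr psiC Js; have QP := has_derive_sqr phiC Js.
have SP := has_derive_sqr vphiC Js.
have S1P := has_derive_sqr (smooth_on_derive1 vphiC) Js.
rewrite -/(P1 s) -/(Q1 s) -/(S1 s) -/(S2 s) in PP QP SP S1P.
apply: has_derive_eq; first by auto_has_derive; rewrite !mulf_neq0.
(* The derivative is [2 s S1 / (S P Q)] times the left-hand side of the first equation. *)
rewrite /= -[RHS](mulr0 (2 * s * S1 s / (S s * P s * Q s))) -ode.
by rewrite -/(P s) -/(Q s) -/(S s) -/(S1 s); field; rewrite Pn Qn Sn.
Qed.

(** If [S1] vanished on all of [J], so would [S2], and the first equation would reduce to
    [P Q / S = 0], against positivity. *)
Lemma derive1_vphi_dense : open J -> J !=set0 -> exists2 s, J s & S1 s != 0.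
Proof.
move=> Jo [s Js]; apply: contrapT => S1n0.
have S10 t : J t -> S1 t = 0.
  by move=> Jt; apply/eqP/negPn/negP => St; apply: S1n0; exists t.
have [_ S2P] := has_derive_sqr (smooth_on_derive1 vphiC) Js.
have /esym/eqP : 0 = S2 s * (2 * s).
  rewrite -[RHS]S2P -(derive_cst 0 s (1 : R)); apply: near_eq_derive.
  have := open_nbhs_nbhs (conj Jo Js); apply: filterS => t Jt.
  by rewrite -/(S1 t) S10.
have s0 := radius_gt0 Js; have [Pp Qp Sp] := coeffs_gt0 Js.
rewrite !mulf_eq0 pnatr_eq0 (gt_eqF s0) !orbF => /eqP S20.
have [+ _] := radial_ode Js; rewrite S10 // S20 !(mulr0, mul0r) subr0 !add0r.
by move/eqP; rewrite gt_eqF // divr_gt0 // mulr_gt0.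
Qed.

Hypotheses (Jopen : open J) (Jitv : is_interval J).
Hypothesis S1n0 : forall s, J s -> S1 s != 0.

Let h s := Num.sqrt (S s).

Lemma h_gt0 s : J s -> 0 < h s.
Proof. by move=> /coeffs_gt0[_ _ Sp]; rewrite /h sqrtr_gt0. Qed.

Lemma h_sqr s : J s -> S s = h s ^+ 2.
Proof. by move=> /coeffs_gt0[_ _ Sp]; rewrite /h sqr_sqrtr // ltW. Qed.

Lemma has_derive_h s : J s -> has_derive s 1 h (s * S1 s / h s).
Proof.
move=> Js; have [_ _ Sp] := coeffs_gt0 Js; have SP := has_derive_sqr vphiC Js.
apply: has_derive_eq; first exact: has_derive_comp (is_derive1_sqrt Sp) SP.
by rewrite -/(h s) -/(S1 s); field; rewrite gt_eqF // h_gt0.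
Qed.

Lemma normalizable_sqrt :
  (exists F, forall x, U x -> J (euclid_r x) ->
     bianchi_metric psi phi vphi x = metric1 mu F (h \o euclid_r) x) \/
  (exists E F : R, E != 0 /\ forall x, U x -> J (euclid_r x) ->
     bianchi_metric psi phi vphi x = metric2 mu E F (h \o euclid_r) x) ->
  normalizable U (bianchi_metric psi phi vphi) mu J.
Proof.
move=> nf; exists h; split=> //.
- apply: (smooth_on_sqrt_sqr (B := D)) => //.
    by move=> t /JU[x Ux <-]; exists x.
  by move=> t /coeffs_gt0[].
- exact: h_gt0.
- move=> s Js; have [_ hE] := has_derive_h Js; rewrite derive1E hE.
  by rewrite !mulf_eq0 invr_eq0 (negbTE (S1n0 Js)) !gt_eqF ?h_gt0 ?radius_gt0.
Qed.

(** Multiplying the invariant by [S] expresses [1 + E S], the quantity under the root in [Omega], as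
    a quotient that is positive because [S1] has no zero. The same identity later eliminates [P]. *)
Lemma invariant_gt0 (E s : R) : J s ->
  s ^+ 2 * S1 s ^+ 2 / (S s * P s * Q s) - (S s)^-1 = E ->
  0 < 1 + E * S s /\ 1 + E * S s = s ^+ 2 * S1 s ^+ 2 / (P s * Q s).
Proof.
move=> Js <-; have [Pp Qp Sp] := coeffs_gt0 Js.
have [Pn Qn Sn] := coeffs_neq0 Js.
have -> : 1 + (s ^+ 2 * S1 s ^+ 2 / (S s * P s * Q s) - (S s)^-1) * S s =
    s ^+ 2 * S1 s ^+ 2 / (P s * Q s).
  by field; rewrite ?Pn ?Qn ?Sn.
split=> //; have s0 := radius_gt0 Js; have S1s := S1n0 Js.
apply: divr_gt0; last exact: mulr_gt0.
by apply: mulr_gt0; [exact: exprn_gt0|rewrite exprn_even_gt0].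
Qed.

Lemma metric1_normal_form :
  (forall s, J s -> 1 = s ^+ 2 * S1 s ^+ 2 / (P s * Q s)) ->
  exists F, forall x, U x -> J (euclid_r x) ->
     bianchi_metric psi phi vphi x = metric1 mu F (h \o euclid_r) x.
Proof.
move=> vE; have [[s0 Js0]|J0] := pselect (J !=set0); last first.
  by exists 0 => x _ Jx; case: J0; exists (euclid_r x).
(* With [S] as coordinate the constraint becomes [(S Q)' = 2 S - 3 mu S^2 / 2]; [f] is its first
   integral, and its value is [F]. *)
pose f s := S s * Q s - S s ^+ 2 + mu / 2 * S s ^+ 3.
have fP s : J s -> has_derive s 1 f 0.
  move=> Js; have [_ ode] := radial_ode Js.
  have [Pn Qn Sn] := coeffs_neq0 Js.
  have QP := has_derive_sqr phiC Js; have SP := has_derive_sqr vphiC Js.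
  rewrite -/(Q1 s) -/(S1 s) in QP SP.
  apply: has_derive_eq; first by auto_has_derive.
  rewrite /= -/(S s) -/(Q s).
  have S1s := S1n0 Js.
  have vQ : 2 * Q1 s * S s / S1 s + 2 * Q s - 4 * S s + 3 * mu * S s ^+ 2 = 0.
    set Z := (X in X = 0) in ode; set V := s ^+ 2 * S1 s ^+ 2 / (P s * Q s).
    (* After multiplication by [S^2] the constraint contains [P] only through [V], and [V = 1]. *)
    transitivity (S s ^+ 2 * Z + (1 - V) * (2 * Q1 s * S s / S1 s + Q s)).
      by rewrite /Z /V; field; rewrite S1s Pn Qn Sn.
    by rewrite ode /V -(vE s Js) subrr mul0r mulr0 addr0.
  set Z := (X in X = 0) in vQ.
  transitivity (s * S1 s * Z); last by rewrite vQ mulr0.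
  by rewrite /Z; field.
exists (f s0) => x Ux Jx; set s := euclid_r x in Jx *.
rewrite -(has_derive0_cst Jitv fP Jx Js0).
have [Pn Qn Sn] := coeffs_neq0 Jx.
have hp := h_gt0 Jx; have hS := h_sqr Jx.
have Qh : Q s / S s = 1 + f s * h s ^- 4 - mu / 2 * h s ^+ 2.
  by rewrite /f !hS; field; rewrite gt_eqF.
apply: (bianchi_reparam (mem_neq0 U0 Ux) (has_derive_h Jx)); rewrite -/s.
- rewrite -/(P s) -Qh exprMn exprVn -hS.
  (* Multiplying by [1 = s^2 S1^2 / (P Q)] cancels [P] and leaves [(S / Q) h'^2]. *)
  rewrite -[LHS]mulr1 [X in _ * X](vE s Jx); field.
  by rewrite ?Pn ?Qn ?Sn.
- by rewrite -Qh -hS -/(Q s) divfK.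
- exact: hS.
Qed.

Lemma metric2_normal_form (E : R) : E != 0 ->
  (forall s, J s -> 0 < 1 + E * S s) ->
  (forall s, J s -> 1 + E * S s = s ^+ 2 * S1 s ^+ 2 / (P s * Q s)) ->
  exists F, forall x, U x -> J (euclid_r x) ->
     bianchi_metric psi phi vphi x = metric2 mu E F (h \o euclid_r) x.
Proof.
move=> E0 v0 vE; have [[s0 Js0]|J0] := pselect (J !=set0); last first.
  by exists 0 => x _ Jx; case: J0; exists (euclid_r x).
pose v s := 1 + E * S s.
(* For [y = S Q] as a function of [S] the constraint is [2 v y' - E y = 4 S - 3 mu S^2]. A
   particular solution is [- q] and the homogeneous one is [sqrt v], so [f] is the integration
   constant [F]. *)
pose q s := E ^- 3 * (mu * v s ^+ 2 - 2 * (2 * E + 3 * mu) * v s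
                      - (4 * E + 3 * mu)).
pose f s := (S s * Q s + q s) / Num.sqrt (v s).
have w0 s : J s -> Num.sqrt (v s) != 0.
  by move=> Js; rewrite gt_eqF // sqrtr_gt0 v0.
have fP s : J s -> has_derive s 1 f 0.
  move=> Js; have [_ ode] := radial_ode Js; have [Pn Qn Sn] := coeffs_neq0 Js.
  have QP := has_derive_sqr phiC Js; have SP := has_derive_sqr vphiC Js.
  rewrite -/(Q1 s) -/(S1 s) in QP SP.
  have S1s := S1n0 Js.
  have vP : has_derive s 1 v (E * (S1 s * (2 * s))).
    apply: has_derive_eq; first by rewrite /v; auto_has_derive.
    by rewrite /=; ring.
  have wP : has_derive s 1 (fun t => Num.sqrt (v t))
      ((2 * Num.sqrt (v s))^-1 * (E * (S1 s * (2 * s)))).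
    by apply: (has_derive_comp (F := Num.sqrt) _ vP); exact/is_derive1_sqrt/v0.
  have vQ : v s * (2 * Q1 s * S s / S1 s + Q s) + Q s - 4 * S s
      + 3 * mu * S s ^+ 2 = 0.
    set Z := (X in X = 0) in ode; transitivity (S s ^+ 2 * Z).
      by rewrite /Z /v (vE s Js); field; rewrite S1s Pn Qn Sn.
    by rewrite ode mulr0.
  rewrite /f /q; apply: has_derive_eq; first by auto_has_derive; exact: w0.
  rewrite /= -/(S s) -/(Q s).
  have vw : v s = Num.sqrt (v s) ^+ 2 by rewrite sqr_sqrtr // ltW // v0.
  have w0s := w0 s Js.
  set Z := (X in X = 0) in vQ.
  transitivity (s * S1 s / Num.sqrt (v s) ^+ 3 * Z); last by rewrite vQ mulr0.
  (* Writing [v] as [w^2] and [S] as [(w^2 - 1) / E] makes the identity rational in independent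
     variables. *)
  rewrite /Z; have SE : S s = (Num.sqrt (v s) ^+ 2 - 1) / E.
    by rewrite -vw /v; field.
  move: vw; set w := Num.sqrt (v s) in w0s SE * => vw; rewrite SE vw.
  by field; rewrite E0 w0s S1s.
exists (f s0) => x Ux Jx; set s := euclid_r x in Jx *.
rewrite -(has_derive0_cst Jitv fP Jx Js0).
have [Pn Qn Sn] := coeffs_neq0 Jx.
have hp := h_gt0 Jx; have hS := h_sqr Jx.
have vn : v s != 0 by rewrite gt_eqF // v0.
(* By the choice of [f], the brace [f sqrt v - q] in the denominator is [S Q], and the numerator
   [h^4] is [S^2]. *)
have OmegaE : Omega mu E (f s) (h s) = S s / (v s * Q s).
  rewrite /Omega -hS -/(v s) -/(q s) /f divfK ?w0 // addrK.
  rewrite (exprM (h s) 2 2) -hS; field.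
  by rewrite vn Qn Sn.
apply: (bianchi_reparam (mem_neq0 U0 Ux) (has_derive_h Jx)); rewrite -/s.
- rewrite OmegaE -/(P s) /v (vE s Jx) exprMn exprVn -hS; field.
  by rewrite ?Pn ?Qn ?Sn S1n0 // gt_eqF // radius_gt0.
- rewrite OmegaE -hS -/(v s) -/(Q s); field.
  by rewrite vn Qn Sn.
- exact: hS.
Qed.

Lemma bianchi_normalizable :
  normalizable U (bianchi_metric psi phi vphi) mu J.
Proof.
apply: normalizable_sqrt.
have [E KE] : exists E, forall s, J s ->
    s ^+ 2 * S1 s ^+ 2 / (S s * P s * Q s) - (S s)^-1 = E.
  have [[s0 Js0]|J0] := pselect (J !=set0); last first.
    by exists 0 => s Js; case: J0; exists s.
  (* The constant [E] is the value of the invariant at the radius [s0]. *)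
  by eexists => s Js; exact: (has_derive0_cst Jitv has_derive_invariant Js Js0).
have vE s (Js : J s) := invariant_gt0 Js (KE s Js).
have [E0|E0] := eqVneq E 0; [left|right].
  apply: metric1_normal_form => s Js.
  by have [_ <-] := vE s Js; rewrite E0 mul0r addr0.
exists E; have [s Js|s Js|F FP] := metric2_normal_form E0.
- by have [] := vE s Js.
- by have [] := vE s Js.
- by exists F.
Qed.

End NormalForms.

Theorem theorem8p1 (R : realType) (U : set 'rV[R]_4) (psi phi vphi : R -> R)
    (mu : R) :
  open U -> ~ U 0 ->
  smooth_on [set euclid_r x ^+ 2 | x in U] psi ->
  smooth_on [set euclid_r x ^+ 2 | x in U] phi ->
  smooth_on [set euclid_r x ^+ 2 | x in U] vphi ->
  (forall x, U x -> 0 < psi (euclid_r x ^+ 2)) ->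
  (forall x, U x -> 0 < phi (euclid_r x ^+ 2)) ->
  (forall x, U x -> 0 < vphi (euclid_r x ^+ 2)) ->
  einstein U (bianchi_metric psi phi vphi) mu ->
  (* the radii at which sqrt(vphi(r^2)) is a local coordinate are dense *)
  (forall J : set R, open J -> J !=set0 -> J `<=` [set euclid_r x | x in U] ->
     exists2 s, J s & derive1 vphi (s ^+ 2) != 0) /\
  (* and on every interval of such radii the metric has a normal form *)
  (forall J : set R, open J -> is_interval J ->
     J `<=` [set euclid_r x | x in U] ->
     (forall s, J s -> derive1 vphi (s ^+ 2) != 0) ->
     normalizable U (bianchi_metric psi phi vphi) mu J).
Proof.
move=> Uo U0 psiC phiC vphiC psi0 phi0 vphi0 ein; split=> [J Jo J0 JU|].
  exact: (derive1_vphi_dense U0 JU psiC phiC vphiC psi0 phi0 vphi0 Uo ein Jo).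
move=> J Jo Ji JU S1n0.
exact: (bianchi_normalizable U0 JU psiC phiC vphiC psi0 phi0 vphi0 Uo ein).
Qed.
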